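(* If $x$ is the leftmost path of a (nonempty) $\Sigma^1_1$ closed set of reals, i.e. the leftmost infinite path of $[T]$ for a $\Sigma^1_1$ tree $T\subseteq 2^{<\omega}$, then $x$ is not $\Pi^1_1$-weakly 2-random.
   Context: A generalized $\Pi^1_1$-ML-test is a sequence $(G_m)_{m\in\mathbb{N}}$ of uniformly $\Pi^1_1$ open subsets of $2^\omega$ (i.e. the relation $[\sigma]\subseteq G_m$ is $\Pi^1_1$ in $(m,\sigma)$) such that $\bigcap_m G_m$ is null. $Z$ is $\Pi^1_1$-weakly 2-random if $Z\notin\bigcap_m G_m$ for every generalized $\Pi^1_1$-ML-test. *)

(* Defs.v *)
From HB Require Import structures.
From mathcomp Require Import all_boot all_order all_algebra.
From mathcomp Require Import all_classical all_reals all_analysis.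

Set Implicit Arguments.
Unset Strict Implicit.
Unset Printing Implicit Defensive.

Import Order.TTheory GRing.Theory Num.Theory.

Local Open Scope classical_set_scope.

(* Arithmetical formulas with number variables (de Bruijn indices into a      *)
(* sequence of numbers) and variables for functions nat -> nat.  Number       *)
(* quantifiers only; disjunction and "exists" are the classical duals.        *)

Inductive term : Type :=
  | TVar of nat
  | TZero
  | TSucc of term
  | TAdd of term & term
  | TMul of term & term
  | TApp of nat & term.

Inductive arith : Type :=
  | AEq of term & term
  | ANot of arith
  | AAnd of arith & arith
  | AAll of arith.

Fixpoint teval (F : nat -> nat -> nat) (e : seq nat) (t : term) : nat :=
  match t with
  | TVar i => nth 0 e i
  | TZero => 0
  | TSucc u => (teval F e u).+1
  | TAdd u v => teval F e u + teval F e v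
  | TMul u v => teval F e u * teval F e v
  | TApp j u => F j (teval F e u)
  end.

Fixpoint holds (F : nat -> nat -> nat) (e : seq nat) (a : arith) : Prop :=
  match a with
  | AEq u v => teval F e u = teval F e v
  | ANot b => ~ holds F e b
  | AAnd b c => holds F e b /\ holds F e c
  | AAll b => forall n : nat, holds F (n :: e) b
  end.

(* The position of s in the length-lexicographic enumeration of binary        *)
(* strings: the usual effective bijection between them and nat.               *)
Definition string_code (s : seq bool) : nat :=
  foldl (fun (c : nat) (b : bool) => c.*2 + b.+1) 0 s.

(* Lightface classes (no parameters).  A formula mentions finitely many       *)
(* function variables, so quantifying over the whole assignment F amounts to  *)
(* a finite block of function quantifiers in front of an arithmetical matrix. *)

Definition Sigma11 (A : set (seq bool)) : Prop :=
  exists a : arith, forall s : seq bool,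
    A s <-> exists F : nat -> nat -> nat, holds F [:: string_code s] a.

Definition Pi11 (P : nat -> seq bool -> Prop) : Prop :=
  exists a : arith, forall (m : nat) (s : seq bool),
    P m s <-> forall F : nat -> nat -> nat, holds F [:: m; string_code s] a.

Definition cylinder (s : seq bool) : set cantor_space :=
  [set x | mkseq x (size s) = s].

(* Outer measure of the fair-coin (uniform) measure on Cantor space. *)
Definition coin_outer (R : realType) (A : set cantor_space) : \bar R :=
  ereal_inf [set (\sum_(k <oo) (2^-1 ^+ size (s k))%:E)%E
            | s in [set s : nat -> seq bool | A `<=` \bigcup_k cylinder (s k)]].

Definition null (R : realType) (A : set cantor_space) : Prop :=
  coin_outer R A = 0%E.

Definition generalized_Pi11_ML_test (R : realType)
    (G : nat -> set cantor_space) : Prop :=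
  [/\ forall m, open (G m),
      Pi11 (fun m s => cylinder s `<=` G m)
    & null R (\bigcap_m G m)].

Definition Pi11_weakly_2_random (R : realType) (z : cantor_space) : Prop :=
  forall G : nat -> set cantor_space,
    generalized_Pi11_ML_test R G -> ~ (\bigcap_m G m) z.

Definition is_tree (T : set (seq bool)) : Prop :=
  forall s t : seq bool, prefix s t -> T t -> T s.

Definition paths (T : set (seq bool)) : set cantor_space :=
  [set x | forall n : nat, T (mkseq x n)].

Definition lex_lt (x y : cantor_space) : Prop :=
  exists n : nat,
    [/\ forall i : nat, (i < n)%N -> x i = y i, x n = false & y n = true].

Definition leftmost (A : set cantor_space) (x : cantor_space) : Prop :=
  A x /\ forall y : cantor_space, A y -> x = y \/ lex_lt x y.

(* Main.v *)
Require Import Defs.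
From mathcomp Require Import all_boot all_order all_algebra.
From mathcomp Require Import all_classical all_reals all_analysis.
From mathcomp Require Import zify lra.

(** The strings [u] such that no path of [T] lies lexicographically below
    [u 0 0 0 ...] form a Pi^1_1 set that contains every initial segment of the
    leftmost path [x].  By Skolemization, membership of [u] is well-foundedness
    of a tree of finite approximations, uniformly arithmetical in [u].  Order
    these strings by the rank of their trees, ties being broken by codes, and
    call [u] a record if every string whose zero extension is larger comes later
    in this order.  Let [G m] be the union of the cylinders of the first [m] bits
    of the zero extensions of the records.  Ranks are compared by simulations
    between trees, which makes "[u] is a record" a Pi^1_1 condition.
    For each [m], the earliest [u] whose zero extension agrees with [x] on [m]
    bits is a record, so [x] is in every [G m].  The zero extensions of the
    records are well-ordered by the lexicographic order, so each point of the
    intersection of the [G m] is the largest one in some cylinder; hence the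
    intersection is countable, and null. *)

Set Implicit Arguments.
Unset Strict Implicit.
Unset Printing Implicit Defensive.

Import Order.TTheory GRing.Theory Num.Theory.
Import numFieldNormedType.Exports.

Local Open Scope nat_scope.
Local Open Scope classical_set_scope.

(** * Arithmetical definability *)

(* A polynomial, hence a term of the language; injective but not surjective. *)
Definition npair (x y : nat) : nat := (x + y) * (x + y) + x.

(** With [s = x + y] the value lies between [s * s] and [s * s + s], hence below the next square, so
    it determines [s] and then [x]. *)
Lemma npair_inj x y x' y' : npair x y = npair x' y' -> x = x' /\ y = y'.
Proof.
rewrite /npair => e.
have s : x + y = x' + y'.
  apply/eqP; rewrite eqn_leq; apply/andP; split; rewrite leqNgt;
    apply/negP => h; have := leq_mul h h; lia.
by move: e; rewrite s => /addnI e; split => //; lia.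
Qed.

Section Definability.
Variables (S : Type) (fn : S -> nat -> nat -> nat) (en : S -> seq nat).

(** [S] is a type of contexts, each supplying function variables through [fn] and number variables
    through [en]; a single term has to serve all contexts. *)
Definition termdef (f : S -> nat) : Prop :=
  exists t, forall s, f s = teval (fn s) (en s) t.

Definition arithdef (P : S -> Prop) : Prop :=
  exists a, forall s, P s <-> holds (fn s) (en s) a.

Lemma termdef_var i : termdef (fun s => nth 0 (en s) i).
Proof. by exists (TVar i). Qed.

Lemma termdef0 : termdef (fun=> 0).
Proof. by exists TZero. Qed.

Lemma termdefS f : termdef f -> termdef (fun s => (f s).+1).
Proof. by move=> [t ft]; exists (TSucc t) => s /=; rewrite ft. Qed.

Lemma termdefD f g : termdef f -> termdef g -> termdef (fun s => f s + g s).
Proof. by move=> [t ft] [u gu]; exists (TAdd t u) => s /=; rewrite ft gu. Qed.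

Lemma termdefM f g : termdef f -> termdef g -> termdef (fun s => f s * g s).
Proof. by move=> [t ft] [u gu]; exists (TMul t u) => s /=; rewrite ft gu. Qed.

Lemma termdef_app j f : termdef f -> termdef (fun s => fn s j (f s)).
Proof. by move=> [t ft]; exists (TApp j t) => s /=; rewrite ft. Qed.

Lemma termdef_npair f g :
  termdef f -> termdef g -> termdef (fun s => npair (f s) (g s)).
Proof.
by move=> hf hg; apply: termdefD => //; apply: termdefM; apply: termdefD.
Qed.

Lemma termdef_env (e : S -> seq nat) t :
  (forall i, termdef (fun s => nth 0 (e s) i)) ->
  termdef (fun s => teval (fn s) (e s) t).
Proof.
move=> he; elim: t => /= [i||t ht|t ht u hu|t ht u hu|j t ht].
- exact: he.
- exact: termdef0.
- exact: termdefS.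
- exact: termdefD.
- exact: termdefM.
- exact: termdef_app.
Qed.

Lemma arithdef_ext P Q : (forall s, P s <-> Q s) -> arithdef P -> arithdef Q.
Proof. by move=> PQ [a Pa]; exists a => s; rewrite -PQ. Qed.

Lemma arithdef_eq f g : termdef f -> termdef g -> arithdef (fun s => f s = g s).
Proof. by move=> [t ft] [u gu]; exists (AEq t u) => s /=; rewrite ft gu. Qed.

Lemma arithdefN P : arithdef P -> arithdef (fun s => ~ P s).
Proof. by move=> [a Pa]; exists (ANot a) => s /=; rewrite Pa. Qed.

Lemma arithdef_and P Q :
  arithdef P -> arithdef Q -> arithdef (fun s => P s /\ Q s).
Proof. by move=> [a Pa] [b Qb]; exists (AAnd a b) => s /=; rewrite Pa Qb. Qed.

Lemma arithdef_imp P Q :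
  arithdef P -> arithdef Q -> arithdef (fun s => P s -> Q s).
Proof.
move=> hP hQ; apply: (@arithdef_ext (fun s => ~ (P s /\ ~ Q s))).
  move=> s; split=> [h p|h [p]]; last by apply; apply: h.
  by apply: contrapT => q; apply: h.
by apply: arithdefN; apply: arithdef_and => //; apply: arithdefN.
Qed.

Lemma arithdef_or P Q :
  arithdef P -> arithdef Q -> arithdef (fun s => P s \/ Q s).
Proof.
move=> hP hQ; apply: (@arithdef_ext (fun s => ~ P s -> Q s)).
  move=> s; split=> [h|[//|//]]; by case: (pselect (P s)) => p; [left|right; apply: h].
by apply: arithdef_imp => //; apply: arithdefN.
Qed.

End Definability.

Definition xfn S (fn : S -> nat -> nat -> nat) (p : S * nat) := fn p.1.
Definition xen S (en : S -> seq nat) (p : S * nat) := p.2 :: en p.1.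

Section Quantifiers.
Variables (S : Type) (fn : S -> nat -> nat -> nat) (en : S -> seq nat).

Lemma arithdef_all (P : S -> nat -> Prop) :
  arithdef (xfn fn) (xen en) (fun p => P p.1 p.2) ->
  arithdef fn en (fun s => forall n, P s n).
Proof.
move=> [a Pa]; exists (AAll a) => s /=; split=> h n.
  by apply/(Pa (s, n)); apply: h.
by apply/(Pa (s, n)); apply: h.
Qed.

Lemma arithdef_ex (P : S -> nat -> Prop) :
  arithdef (xfn fn) (xen en) (fun p => P p.1 p.2) ->
  arithdef fn en (fun s => exists n, P s n).
Proof.
move=> hP; apply: (@arithdef_ext _ _ _ (fun s => ~ forall n, ~ P s n)).
  move=> s; split=> [h|[n pn] h]; last exact: h pn.
  by apply: contrapT => h'; apply: h => n pn; apply: h'; exists n.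
apply: arithdefN; apply: (@arithdef_all (fun s n => ~ P s n)).
exact: arithdefN.
Qed.

Lemma termdef_comp (g : S * nat -> nat) f :
  termdef (xfn fn) (xen en) g -> termdef fn en f ->
  termdef fn en (fun s => g (s, f s)).
Proof.
move=> [t gt] hf.
have [i|u hu] := @termdef_env S fn en (fun s => f s :: en s) t.
  by case: i => [|i] //; exact: termdef_var.
by exists u => s; rewrite gt /xfn /xen /= hu.
Qed.

End Quantifiers.

Lemma arithdef_lt S (fn : S -> nat -> nat -> nat) (en : S -> seq nat) f g :
  termdef fn en f -> termdef fn en g -> arithdef fn en (fun s => f s < g s).
Proof.
move=> [t ft] [u gu].
apply: (@arithdef_ext _ _ _ (fun s => exists n, (f s).+1 + n = g s)).
  move=> s; split=> [[n <-]|h]; first by rewrite leq_addr.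
  by exists (g s - (f s).+1); rewrite subnKC.
apply: (@arithdef_ex _ _ _ (fun s n => (f s).+1 + n = g s)).
have wk w : termdef (xfn fn) (xen en) (fun p => teval (fn p.1) (en p.1) w).
  apply: (@termdef_env _ (xfn fn) (xen en) (fun p => en p.1)) => i.
  by exists (TVar i.+1).
have [t' ht] := wk t; have [u' hu] := wk u.
apply: arithdef_eq; last by exists u' => p; rewrite gu hu.
apply: termdefD; last by exists (TVar 0).
by apply: termdefS; exists t' => p; rewrite ft ht.
Qed.

(** Substitution: the function variables of [a] become functions [G] that are themselves given by
    terms, whose argument is variable 0 of the enlarged context. *)
Lemma arithdef_holds a : forall S (fn : S -> nat -> nat -> nat)
    (en : S -> seq nat) (G : S -> nat -> nat -> nat) (e : S -> seq nat),
  (forall j, termdef (xfn fn) (xen en) (fun p => G p.1 j p.2)) ->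
  (forall i, termdef fn en (fun s => nth 0 (e s) i)) ->
  arithdef fn en (fun s => holds (G s) (e s) a).
Proof.
have tev t : forall S (fn : S -> nat -> nat -> nat)
    (en : S -> seq nat) (G : S -> nat -> nat -> nat) (e : S -> seq nat),
  (forall j, termdef (xfn fn) (xen en) (fun p => G p.1 j p.2)) ->
  (forall i, termdef fn en (fun s => nth 0 (e s) i)) ->
  termdef fn en (fun s => teval (G s) (e s) t).
  move=> S fn en G e hG he; elim: t => /= [i||t ht|t ht u hu|t ht u hu|j t ht].
  - exact: he.
  - exact: termdef0.
  - exact: termdefS.
  - exact: termdefD.
  - exact: termdefM.
  - exact: (termdef_comp (hG j) ht).
elim: a => [t u|b IH|b IHb c IHc|b IH] S fn en G e hG he /=.
- by apply: arithdef_eq; apply: tev.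
- by apply: arithdefN; apply: IH.
- by apply: arithdef_and; [apply: IHb|apply: IHc].
- apply: (@arithdef_all _ _ _ (fun s n => holds (G s) (n :: e s) b)).
  apply: (IH _ _ _ (fun p => G p.1) (fun p => p.2 :: e p.1)) => [j|[|i]] /=.
  (* Index 0 is the argument of [G] and index 1 the number just bound, so older variables move from
     [i.+1] to [i.+2]. *)
  + have [t Gt] := hG j.
    have [[|i]|u hu] := @termdef_env _ (xfn (xfn fn)) (xen (xen en))
                          (fun q => q.2 :: en q.1.1) t.
    * by exists (TVar 0).
    * by exists (TVar i.+2).
    * by exists u => q; rewrite (Gt (q.1.1, q.2)) -hu.
  + by exists (TVar 0).
  + have [t et] := he i.
    have [k|u hu] := @termdef_env _ (xfn fn) (xen en) (fun p => en p.1) t.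
      by exists (TVar k.+1).
    by exists u => p; rewrite et -hu.
Qed.

Lemma arithdef_holds2 a S (fn : S -> nat -> nat -> nat) (en : S -> seq nat) f g :
  termdef fn en f -> termdef fn en g ->
  arithdef fn en (fun s => holds (fn s) [:: f s; g s] a).
Proof.
move=> hf hg; apply: arithdef_holds => [j|[|[|i]]] //=.
  by apply: (@termdef_app _ (xfn fn)); exists (TVar 0).
by rewrite nth_nil; exact: termdef0.
Qed.

Ltac tm := cbv beta; solve [ repeat first
  [ match goal with |- termdef _ _ _ => first
      [ exists (TVar 0); reflexivity | exists (TVar 1); reflexivity
      | exists (TVar 2); reflexivity | exists (TVar 3); reflexivity
      | exists (TVar 4); reflexivity | exists (TVar 5); reflexivity
      | exists (TVar 6); reflexivity | exists (TVar 7); reflexivity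
      | exists (TVar 8); reflexivity ] end
  | apply: termdef0 | apply: termdefS | apply: termdef_npair | apply: termdefD
  | apply: termdefM | apply: termdef_app ] ].

Ltac ad := cbv beta; repeat (first
  [ apply: arithdef_lt; [tm|tm] | apply: arithdef_eq; [tm|tm]
  | apply: arithdef_and | apply: arithdef_or | apply: arithdefN
  | apply: arithdef_ex | apply: arithdef_all | apply: arithdef_imp ]; cbv beta).

(** * Skolem normal form *)

Definition agree (N : nat) (F F' : nat -> nat -> nat) : Prop :=
  forall j x, j < N -> x < N -> F' j x = F j x.

Lemma agreeW M N F F' : M <= N -> agree N F F' -> agree M F F'.
Proof. by move=> MN h j x jM xM; apply: h; apply: leq_trans MN. Qed.

Definition consfun (g : nat -> nat) (F : nat -> nat -> nat) (j : nat) :=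
  if j is j'.+1 then F j' else g.

(* Slice indices start at 1, so the value of [F 0] at [0] stays free for a
   numeric witness. *)
Definition slice (i : nat) (F : nat -> nat -> nat) (j x : nat) : nat :=
  if j is 0 then F 0 (npair i.+1 x) else F j x.

Lemma slice_agree i N F F' :
  agree (npair i.+1 N).+1 F F' -> agree N (slice i F) (slice i F').
Proof.
move=> h [|j] x jN xN /=; apply: h => //.
- by rewrite /npair; nia.
- by rewrite /npair; nia.
- by rewrite /npair; nia.
Qed.

(** Evaluation consults finitely many values; at [TApp] the bound must also exceed the function
    index and the evaluated argument. *)
Lemma teval_continuous F e t :
  exists N, forall F', agree N F F' -> teval F' e t = teval F e t.
Proof.
elim: t => /= [i||t [N h]|t [N h] u [M k]|t [N h] u [M k]|j t [N h]].
- by exists 0.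
- by exists 0.
- by exists N => F' /h ->.
- exists (maxn N M) => F' hF; rewrite h ?k //; apply: agreeW hF; lia.
- exists (maxn N M) => F' hF; rewrite h ?k //; apply: agreeW hF; lia.
- exists (maxn N (maxn j (teval F e t)).+1) => F' hF.
  rewrite h; last by apply: agreeW hF; lia.
  by apply: hF; lia.
Qed.

Definition continuous_matrix (Q : (nat -> nat -> nat) -> nat -> seq nat -> Prop) :=
  forall F k e, exists N, forall F', agree N F F' -> (Q F' k e <-> Q F k e).

Definition arith_matrix (Q : (nat -> nat -> nat) -> nat -> seq nat -> Prop) :=
  arithdef (fun s : (nat -> nat -> nat) * (nat * seq nat) => s.1)
           (fun s => s.2.1 :: s.2.2) (fun s => Q s.1 s.2.1 s.2.2).

(** One Skolem function in slot 0 and one universal number [k] absorb all number quantifiers. Each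
    instance of the matrix then depends on finitely many values, which makes the solutions the
    branches of a tree. *)
Definition skolem (P : (nat -> nat -> nat) -> seq nat -> Prop) : Prop :=
  exists Q, [/\ continuous_matrix Q, arith_matrix Q
    & forall F e, P F e <-> exists g, forall k, Q (consfun g F) k e].

Lemma skolem_ext P P' : (forall F e, P F e <-> P' F e) -> skolem P -> skolem P'.
Proof. by move=> PP [Q [cQ aQ hQ]]; exists Q; split=> // F e; rewrite -PP. Qed.

Lemma arith_matrix_slice Q i : arith_matrix Q ->
  arith_matrix (fun F k e => Q (slice i F) k e).
Proof.
move=> [a Qa].
have := @arithdef_holds a _ (fun s : (nat -> nat -> nat) * (nat * seq nat) => s.1)
  (fun s => s.2.1 :: s.2.2) (fun s => slice i s.1) (fun s => s.2.1 :: s.2.2).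
case=> [[|j]|k|b hb].
- have c : termdef (xfn (fun s : (nat -> nat -> nat) * (nat * seq nat) => s.1))
    (xen (fun s : (nat -> nat -> nat) * (nat * seq nat) => s.2.1 :: s.2.2))
    (fun=> i.+1).
    by elim: (i.+1) => [|n ih]; [exact: termdef0|exact: termdefS].
  by apply: (@termdef_app _ (xfn _)); apply: termdef_npair => //; tm.
- by apply: (@termdef_app _ (xfn _)); tm.
- exact: termdef_var.
- by exists b => s; rewrite -hb (Qa (slice i s.1, s.2)).
Qed.

Lemma continuous_matrix_slice Q i : continuous_matrix Q ->
  continuous_matrix (fun F k e => Q (slice i F) k e).
Proof.
move=> cQ F k e; have [N h] := cQ (slice i F) k e.
exists (npair i.+1 N).+1 => F' hF; apply: h; exact: slice_agree.
Qed.

Lemma slice_consfun i g F :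
  slice i (consfun g F) = consfun (fun x => g (npair i.+1 x)) F.
Proof. by apply/funext => -[|j]; apply/funext. Qed.

Lemma npair_join (G : nat -> nat -> nat) :
  exists h : nat -> nat, forall i x, h (npair i x) = G i x.
Proof.
pose h z := if pselect (exists p : nat * nat, z = npair p.1 p.2) is left e
            then let p := sval (cid e) in G p.1 p.2 else 0.
exists h => i x; rewrite /h; case: pselect => [e|[]]; last by exists (i, x).
by case: (cid e) => p /= hp; have [-> ->] := npair_inj hp.
Qed.

(** As [npair 0 0] is 0, the value [c] is stored in column 0, which no [slice] reads. *)
Lemma skolem_join (g : nat -> nat -> nat) (c : nat) : exists h : nat -> nat,
  h 0 = c /\ forall i, (fun x => h (npair i.+1 x)) = g i.
Proof.
have [h hh] := npair_join (fun i => if i is j.+1 then g j else fun=> c).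
by exists h; split=> [|i]; [exact: (hh 0 0)|apply/funext => x; rewrite hh].
Qed.

Lemma skolem_and P1 P2 :
  skolem P1 -> skolem P2 -> skolem (fun F e => P1 F e /\ P2 F e).
Proof.
move=> [Q1 [c1 a1 h1]] [Q2 [c2 a2 h2]].
exists (fun F k e => Q1 (slice 0 F) k e /\ Q2 (slice 1 F) k e); split.
- move=> F k e.
  have [N hN] := continuous_matrix_slice 0 c1 F k e.
  have [M hM] := continuous_matrix_slice 1 c2 F k e.
  exists (maxn N M) => F' hF; rewrite hN ?hM //; apply: agreeW hF; lia.
- by apply: arithdef_and; apply: arith_matrix_slice.
- move=> F e; rewrite h1 h2; split=> [[[g1 k1] [g2 k2]]|[g hg]].
    have [g [_ hg]] := skolem_join (fun i => if i is 0 then g1 else g2) 0.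
    by exists g => k; rewrite !slice_consfun !hg.
  split; [exists (fun x => g (npair 1 x))|exists (fun x => g (npair 2 x))] => k;
    by have [] := hg k; rewrite !slice_consfun.
Qed.

(** The value of the Skolem function at 0 selects the disjunct, 0 standing for the first. *)
Lemma skolem_or P1 P2 :
  skolem P1 -> skolem P2 -> skolem (fun F e => P1 F e \/ P2 F e).
Proof.
move=> [Q1 [c1 a1 h1]] [Q2 [c2 a2 h2]].
exists (fun F k e => (F 0 0 = 0 -> Q1 (slice 0 F) k e) /\
                     (~ F 0 0 = 0 -> Q2 (slice 1 F) k e)); split.
- move=> F k e.
  have [N hN] := continuous_matrix_slice 0 c1 F k e.
  have [M hM] := continuous_matrix_slice 1 c2 F k e.
  exists (maxn 1 (maxn N M)) => F' hF; rewrite hN ?hM ?hF //;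
    by [apply: agreeW hF; lia | lia].
- apply: arithdef_and; apply: arithdef_imp; try exact: arith_matrix_slice; ad.
- move=> F e; rewrite h1 h2; split=> [[[g1 k1]|[g2 k2]]|[g hg]].
  + have [g [g0 hg]] := skolem_join (fun=> g1) 0.
    by exists g => k; rewrite !slice_consfun !hg /= g0.
  + have [g [g0 hg]] := skolem_join (fun=> g2) 1.
    by exists g => k; rewrite !slice_consfun !hg /= g0.
  + case: (pselect (g 0 = 0)) => g0; [left|right].
      exists (fun x => g (npair 1 x)) => k; have [/(_ g0)] := hg k.
      by rewrite slice_consfun.
    exists (fun x => g (npair 2 x)) => k; have [_ /(_ g0)] := hg k.
    by rewrite slice_consfun.
Qed.

(** The value of the Skolem function at 0 is the witness [n]. *)
Lemma skolem_ex (P : (nat -> nat -> nat) -> seq nat -> Prop) :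
  skolem P -> skolem (fun F e => exists n, P F (n :: e)).
Proof.
move=> [Q [cQ aQ hQ]].
exists (fun F k e => Q (slice 0 F) k (F 0 0 :: e)); split.
- move=> F k e.
  have [N hN] := continuous_matrix_slice 0 cQ F k (F 0 0 :: e).
  exists (maxn 1 N) => F' hF.
  have -> : F' 0 0 = F 0 0 by apply: hF; lia.
  by apply: hN; apply: agreeW hF; lia.
- have [a Qa] := arith_matrix_slice 0 aQ.
  have := @arithdef_holds a _ (fun s : (nat -> nat -> nat) * (nat * seq nat) => s.1)
    (fun s => s.2.1 :: s.2.2) (fun s => s.1)
    (fun s => s.2.1 :: s.1 0 0 :: s.2.2).
  case=> [j|[|[|k]]|b hb].
  + by apply: (@termdef_app _ (xfn _)); tm.
  + by exists (TVar 0).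
  + by tm.
  + by exists (TVar k.+1).
  + by exists b => s; rewrite -hb (Qa (s.1, (s.2.1, s.1 0 0 :: s.2.2))).
- move=> F e; split=> [[n /hQ[g hg]]|[g hg]].
    have [g' [g0 hg']] := skolem_join (fun=> g) n.
    by exists g' => k; rewrite slice_consfun hg' /= g0.
  exists (g 0); apply/hQ; exists (fun x => g (npair 1 x)) => k.
  by have := hg k; rewrite slice_consfun.
Qed.

(** Slice [n] holds a Skolem function for the instance [n]. The universal number becomes a code [p]
    of the pair of [k] and [n]; numbers that code no pair impose no condition. *)
Lemma skolem_all (P : (nat -> nat -> nat) -> seq nat -> Prop) :
  skolem P -> skolem (fun F e => forall n, P F (n :: e)).
Proof.
move=> [Q [cQ aQ hQ]].
exists (fun F p e => forall n k, p = npair k n -> Q (slice n F) k (n :: e)); split.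
- move=> F p e; case: (pselect (exists q : nat * nat, p = npair q.1 q.2)) => [[[k n] /= ->]|h].
    have [N hN] := continuous_matrix_slice n cQ F k (n :: e).
    exists N => F' /hN hF; split=> h n' k' /[dup] /npair_inj[<- <-] _; apply/hF;
      exact: h.
  by exists 0 => F' _; split=> _ n k pe; case: h; exists (k, n).
- have [a Qa] := aQ.
  apply: arithdef_all; apply: arithdef_all; apply: arithdef_imp; first by ad.
  have := @arithdef_holds a _
    (xfn (xfn (fun s : (nat -> nat -> nat) * (nat * seq nat) => s.1)))
    (xen (xen (fun s => s.2.1 :: s.2.2)))
    (fun s => slice s.1.2 s.1.1.1)
    (fun s => s.2 :: s.1.2 :: s.1.1.2.2).
  case=> [[|j]|[|[|k]]|b hb].
  + apply: (@termdef_app _ (xfn _)); apply: termdef_npair; tm.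
  + by apply: (@termdef_app _ (xfn _)); tm.
  + by exists (TVar 0).
  + by exists (TVar 1).
  + by exists (TVar k.+3).
  + exists b => s; rewrite -hb.
    exact: (Qa (slice s.1.2 s.1.1.1, (s.2, s.1.2 :: s.1.1.2.2))).
- move=> F e; split=> [h|[g hg] n].
    have /choice[G hG] : forall n, exists g, forall k, Q (consfun g F) k (n :: e).
      by move=> n; apply/hQ.
    have [g [_ hg]] := skolem_join G 0.
    by exists g => _ n k _; rewrite slice_consfun hg.
  apply/hQ; exists (fun x => g (npair n.+1 x)) => k.
  by have := hg _ n k erefl; rewrite slice_consfun.
Qed.

(** A formula and its negation are treated together, because the negation of a conjunction or of a
    universal formula calls for [skolem_or] or [skolem_ex] on negated subformulas. *)
Lemma skolem_holds a :
  skolem (fun F e => holds F e a) /\ skolem (fun F e => ~ holds F e a).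
Proof.
elim: a => [t u|b [IHp IHn]|b [bp bn] c [cp cn]|b [bp bn]] /=.
(* Slot 0 is taken by the Skolem function, so the functions of the formula sit at [j.+1]; for an
   atom any Skolem function will do. *)
- have := @arithdef_holds (AEq t u) _ (fun s : (nat -> nat -> nat) * (nat * seq nat) => s.1)
    (fun s => s.2.1 :: s.2.2) (fun s j => s.1 j.+1) (fun s => s.2.2).
  case=> [j|k|b hb].
  + by apply: (@termdef_app _ (xfn _)); tm.
  + by exists (TVar k.+1).
  have am : arith_matrix (fun F (k : nat) e =>
      teval (fun j => F j.+1) e t = teval (fun j => F j.+1) e u) by exists b.
  have cm : continuous_matrix (fun F (k : nat) e =>
      teval (fun j => F j.+1) e t = teval (fun j => F j.+1) e u).
    move=> F k e.
    have [N hN] := teval_continuous (fun j => F j.+1) e t.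
    have [M hM] := teval_continuous (fun j => F j.+1) e u.
    exists (maxn N M).+1 => F' hF.
    by rewrite hN ?hM // => j x jN xN; apply: hF; lia.
  split; [exists (fun F (k : nat) e =>
      teval (fun j => F j.+1) e t = teval (fun j => F j.+1) e u)
   |exists (fun F (k : nat) e =>
      ~ teval (fun j => F j.+1) e t = teval (fun j => F j.+1) e u)];
   split=> //.
  + by move=> F e; split=> [h|[_ /(_ 0)//]]; exists id.
  + by move=> F k e; have [N hN] := cm F k e; exists N => F' /hN ->.
  + exact: arithdefN.
  + by move=> F e; split=> [h|[_ /(_ 0)//]]; exists id.
- split=> //; apply: skolem_ext IHp => F e; split=> [h //|]; exact: contrapT.
- split; first exact: skolem_and.
  apply: skolem_ext (skolem_or bn cn) => F e; split=> [[h []|h []] //|h].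
  case: (pselect (holds F e b)) => hb; [right=> hc|by left].
  by apply: h.
- split; first exact: (skolem_all bp).
  apply: skolem_ext (skolem_ex bn) => F e; split=> [[n h] /(_ n)//|h].
  by apply: contrapT => h'; apply: h => n; apply: contrapT => hn; apply: h'; exists n.
Qed.

(** * Trees of finite approximations *)

Definition entry (c i : nat) : nat := nth 0 (CodeSeq.decode c) i.

Lemma entry0 i : entry 0 i = 0.
Proof. by rewrite /entry nth_default. Qed.

Lemma entry_code s i : entry (CodeSeq.code s) i = nth 0 s i.
Proof. by rewrite /entry CodeSeq.codeK. Qed.

(** The code of [n :: s] is 2^n times 2m+1, where m is the code of [s]. Odd codes therefore have
    head 0, and doubling a nonzero code increments its head. *)
Lemma decode_odd m : CodeSeq.decode (m + m).+1 = 0 :: CodeSeq.decode m.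
Proof.
rewrite -[RHS]CodeSeq.codeK; congr CodeSeq.decode.
by rewrite /= CodeSeq.decodeK mul1n addnn.
Qed.

Lemma decode_even c : exists n s,
  CodeSeq.decode c.+1 = n :: s /\ CodeSeq.decode (c.+1 + c.+1) = n.+1 :: s.
Proof.
case E : (CodeSeq.decode c.+1) => [|n s].
  by have := CodeSeq.decodeK c.+1; rewrite E.
exists n, s; split=> //; rewrite -[RHS]CodeSeq.codeK; congr CodeSeq.decode.
by rewrite -[c.+1]CodeSeq.decodeK E /= expnS -mulnA mul2n addnn.
Qed.

(* An arithmetical characterization, so that [entry] can be used in Pi^1_1
   formulas through a universally quantified function variable. *)
Definition entry_spec (d : nat -> nat) : Prop :=
  (forall i, d (npair 0 i) = 0) /\
  (forall m, d (npair (m + m).+1 0) = 0) /\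
  (forall m i, d (npair (m + m).+1 i.+1) = d (npair m i)) /\
  (forall c, d (npair (c.+1 + c.+1) 0) = (d (npair c.+1 0)).+1) /\
  (forall c i, d (npair (c.+1 + c.+1) i.+1) = d (npair c.+1 i.+1)).

(** Every positive number is odd or twice a smaller positive number, so the clauses fix all values
    at pairs by strong induction. *)
Lemma entry_specP d :
  entry_spec d <-> forall c i, d (npair c i) = entry c i.
Proof.
split=> [[h0 [h1 [h2 [h3 h4]]]] c|h]; last first.
  split; [|split; [|split; [|split]]] => [i|m|m i|c|c i]; rewrite !h.
  - exact: entry0.
  - by rewrite /entry decode_odd.
  - by rewrite /entry decode_odd.
  - by rewrite /entry; have [n [s [-> ->]]] := decode_even c.
  - by rewrite /entry; have [n [s [-> ->]]] := decode_even c.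
elim/ltn_ind: c => c IH i; case: c IH => [|c] IH.
  by rewrite h0 entry0.
have [m [e|e]] : exists m, c.+1 = (m + m).+1 \/ c.+1 = m.+1 + m.+1.
  exists (c./2); have := odd_double_half c; rewrite -addnn.
  by case: odd => /=; [right|left]; lia.
- rewrite e; case: i => [|i]; first by rewrite h1 /entry decode_odd.
  rewrite h2 IH; last lia.
  by rewrite /entry decode_odd.
- have [n [s [e1 e2]]] := decode_even m.
  rewrite e; case: i => [|i]; rewrite ?h3 ?h4 IH; try lia;
    by rewrite /entry e1 e2.
Qed.

(** A node [npair u (npair n c)] carries a string code [u], a depth [n] and the code [c] of a finite
    sequence; the root has depth 0 and the empty sequence. *)
Definition troot (u : nat) : nat := npair u (npair 0 0).

Lemma infinite_path (ch : nat -> nat -> Prop) p0 :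
  ~ Acc (fun y x => ch x y) p0 ->
  exists p : nat -> nat, p 0 = p0 /\ forall n, ch (p n) (p n.+1).
Proof.
move=> np.
have /choice[f hf] : forall p, exists q,
    ~ Acc (fun y x => ch x y) p -> ch p q /\ ~ Acc (fun y x => ch x y) q.
  move=> p; case: (pselect (Acc (fun y x => ch x y) p)) => ap; first by exists 0.
  apply: contrapT => h; apply: ap; constructor=> q pq.
  by apply: contrapT => aq; apply: h; exists q.
exists (fun n => iter n f p0); split=> // n.
have [] // := hf (iter n f p0).
by elim: n => //= n /hf[].
Qed.

Lemma not_Acc_path (ch : nat -> nat -> Prop) (p : nat -> nat) :
  (forall n, ch (p n) (p n.+1)) -> ~ Acc (fun y x => ch x y) (p 0).
Proof.
move=> hp; suff h q : Acc (fun y x => ch x y) q -> forall n, q <> p n.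
  by move=> /h/(_ 0).
elim=> {}q _ IH n e; apply: (IH (p n.+1) _ n.+1 erefl).
by rewrite e.
Qed.

(** The Sigma^1_1 condition on [u] becomes ill-foundedness of the tree below [troot u], with one
    child relation for all [u] that is arithmetical once function variable 0 computes [entry]. *)
Lemma tree_normal_form b : exists ch : nat -> nat -> Prop,
  (exists a, forall F p q, (forall c i, F 0 (npair c i) = entry c i) ->
     (holds F [:: p; q] a <-> ch p q)) /\
  (forall u, (exists F, holds F [:: u] b) <->
             ~ Acc (fun y x => ch x y) (troot u)).
Proof.
have [[Q [cQ [a Qa] hQ]] _] := skolem_holds b.
(* The sequence coded by [c], padded with zeros, is read as a family of functions laid out along
   [npair]. *)
pose Fc (d : nat -> nat) c j x := d (npair c (npair j x)).
(* A node is dropped only when all its finite extensions refute one of the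
   first [n] instances of the matrix; by continuity no infinite branch is lost
   and every infinite branch is a solution. *)
pose alive d u n c := forall k, k < n -> exists c',
  (forall i, i < n -> d (npair c' i) = d (npair c i)) /\ Q (Fc d c') k [:: u].
pose chd d p q := exists u n c c', p = npair u (npair n c) /\
  q = npair u (npair n.+1 c') /\
  (forall i, i < n -> d (npair c' i) = d (npair c i)) /\ alive d u n.+1 c'.
pose d0 := sval (cid (npair_join entry)).
have d0E c i : d0 (npair c i) = entry c i by rewrite /d0; case: cid.
exists (chd d0); split.
  have [af haf] : arithdef
      (fun s : (nat -> nat -> nat) * nat * nat => s.1.1) (fun s => [:: s.1.2; s.2])
      (fun s => chd (s.1.1 0) s.1.2 s.2).
    rewrite /chd /alive; ad.
    set fn := (X in arithdef X); set en := (X in arithdef _ X).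
    have := @arithdef_holds a _ fn en (fun s => Fc (fn s 0) s.2)
      (fun s => [:: s.1.2; s.1.1.1.1.1.2]).
    case=> [j|[|[|i]]|f hf].
    + rewrite /Fc; apply: (@termdef_app _ (xfn fn)).
      apply: termdef_npair; first tm.
      apply: termdef_npair; last tm.
      by elim: j => [|n ih]; [exact: termdef0|exact: termdefS].
    + tm.
    + tm.
    + by exists TZero => s; rewrite /= nth_nil.
    + exists f => s; rewrite -hf.
      exact: (Qa (Fc (fn s 0) s.2, (s.1.2, [:: s.1.1.1.1.1.2]))).
  exists af => F p q hF; rewrite -(haf (F, p, q)) /=.
  have FE c i : F 0 (npair c i) = d0 (npair c i) by rewrite hF d0E.
  have FcE c : Fc (F 0) c = Fc d0 c.
    by apply/funext => j; apply/funext => x; rewrite /Fc FE.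
  have aE u n c : alive (F 0) u n c <-> alive d0 u n c.
    by split=> h k /h[c' [h1 h2]]; exists c'; split;
      [move=> i /h1; rewrite !FE|rewrite -?FcE // FcE
      |move=> i /h1; rewrite !FE|rewrite FcE].
  by split=> -[u [n [c [c' [e1 [e2 [e3 /aE e4]]]]]]]; exists u, n, c, c';
    do 3?split=> //; move=> i /e3; rewrite !FE.
move=> u; have -> : (exists F, holds F [:: u] b) <->
    exists F, forall k, Q F k [:: u].
  split=> [[F /hQ[g hg]]|[F hF]]; first by exists (consfun g F).
  exists (fun j => F j.+1); apply/hQ; exists (F 0) => k.
  by rewrite (_ : consfun _ _ = F) //; apply/funext => -[|j].
have npair_mono j x N : j < N -> x < N -> npair j x < npair N N.
  by rewrite /npair => jN xN; have := leq_mul (leq_add jN xN) (leq_add jN xN); lia.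
split=> [[F hF]|/infinite_path[p [p0 hp]]].
- have [H HE] := npair_join F.
  pose cc n := CodeSeq.code (mkseq H n).
  have ccE n i : i < n -> d0 (npair (cc n) i) = H i.
    by move=> ni; rewrite d0E entry_code nth_mkseq.
  have rE : troot u = npair u (npair 0 (cc 0)) by [].
  rewrite rE; apply: (@not_Acc_path _ (fun n => npair u (npair n (cc n)))) => n.
  exists u, n, (cc n), (cc n.+1); split=> //; split=> //; split=> [i ni|k kn].
    by rewrite !ccE // ltnW.
  (* Instance [k] is decided by the values with index and argument below [N]; an initial segment of
     length [npair N N] contains them all. *)
  have [N hN] := cQ F k [:: u].
  exists (cc (maxn n.+1 (npair N N))); split=> [i ni|].
    by rewrite !ccE //; lia.
  apply/hN => // j x jN xN; rewrite /Fc ccE ?HE //.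
  by have := npair_mono _ _ _ jN xN; lia.
- have /choice[c hc] : forall n, exists c, p n = npair u (npair n c).
    elim=> [|n [c hc]]; first by exists 0.
    have [u' [m [c1 [c2 [e1 [e2 _]]]]]] := hp n.
    move: e1; rewrite hc => /npair_inj[uu /npair_inj[mm _]].
    by exists c2; rewrite e2 uu mm.
  have hs n : (forall i, i < n -> d0 (npair (c n.+1) i) = d0 (npair (c n) i)) /\
      alive d0 u n.+1 (c n.+1).
    have [u' [m [c1 [c2 [e1 [e2 [e3 e4]]]]]]] := hp n.
    move: e1; rewrite hc => /npair_inj[uu /npair_inj[mm cc]].
    move: e2; rewrite hc => /npair_inj[_ /npair_inj[_ ->]].
    by rewrite cc uu mm.
  (* Entry [i] is frozen from depth [i.+1] on, so this diagonal is the limit of the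
     approximations. *)
  pose H i := d0 (npair (c i.+1) i).
  have cH n i : i < n -> d0 (npair (c n) i) = H i.
    elim: n => // n IH; rewrite ltnS leq_eqVlt => /orP[/eqP -> //|ni].
    by rewrite (hs n).1 // IH.
  exists (fun j x => H (npair j x)) => k.
  have [N hN] := cQ (fun j x => H (npair j x)) k [:: u].
  (* At this depth the node has an extension satisfying instance [k] and agreeing with [H] on all
     values that decide it. *)
  pose n := maxn k (npair N N).
  have [|c' [h1 h2]] := (hs n).2 k; first by rewrite /n; lia.
  apply/(hN (Fc d0 c')) => // j x jN xN; rewrite /Fc.
  have := npair_mono _ _ _ jN xN => lt.
  by rewrite h1 ?cH //; rewrite /n; lia.
Qed.

(** * Comparison of ranks by simulations *)

Section Simulation.
Variable ch : nat -> nat -> Prop.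

Definition simulation (r : nat -> nat -> Prop) : Prop :=
  forall p q, r p q -> forall p', ch p p' -> exists q', ch q q' /\ r p' q'.

(** On well-founded nodes this says that the rank of [p] is at most that of [q]; no ordinals are
    needed to express it. *)
Definition sim (p q : nat) : Prop := exists r, simulation r /\ r p q.

Local Notation acc := (Acc (fun y x => ch x y)).

Lemma sim_refl p : sim p p.
Proof.
exists eq; split=> // {}p _ <- p' pp'; by exists p'.
Qed.

Lemma sim_trans q p s : sim p q -> sim q s -> sim p s.
Proof.
move=> [r1 [h1 r1pq]] [r2 [h2 r2qs]].
exists (fun x z => exists y, r1 x y /\ r2 y z); split; last by exists q.
move=> x z [y [xy yz]] x' xx'; have [y' [yy' xy']] := h1 _ _ xy _ xx'.
have [z' [zz' yz']] := h2 _ _ yz _ yy'; exists z'; split=> //; by exists y'.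
Qed.

Lemma sim_child p q p' : sim p q -> ch p p' -> exists q', ch q q' /\ sim p' q'.
Proof.
move=> [r [hr rpq]] /(hr _ _ rpq)[q' [qq' r']]; exists q'; split=> //.
by exists r.
Qed.

Lemma sim_intro p q :
  (forall p', ch p p' -> exists q', ch q q' /\ sim p' q') -> sim p q.
Proof.
move=> h; exists (fun x y => sim x y \/ (x = p /\ y = q)); split; last by right.
move=> x y [xy|[-> ->]] x' xx'.
  by have [y' [? ?]] := sim_child xy xx'; exists y'; split=> //; left.
by have [y' [? ?]] := h _ xx'; exists y'; split=> //; left.
Qed.

(** Linearity of ranks: the second alternative says that the rank of [q] is strictly below that of
    [p]. *)
Lemma sim_total q : acc q ->
  forall p, sim p q \/ exists p', ch p p' /\ sim q p'.
Proof.
elim=> {}q _ IH p.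
case: (pselect (exists p', ch p p' /\ forall q', ch q q' -> ~ sim p' q')) => [[p' [pp' h]]|h].
  right; exists p'; split=> //; apply: sim_intro => q' qq'.
  by have [/(h _ qq')|] := IH _ qq' p'.
left; apply: sim_intro => p' pp'; apply: contrapT => h'; apply: h.
exists p'; split=> // q' qq' s; by apply: h'; exists q'.
Qed.

Lemma sim_acc p q : sim p q -> acc q -> acc p.
Proof.
move=> pq aq; elim: aq p pq => {}q _ IH p pq; constructor=> p' pp'.
by have [q' [qq' s]] := sim_child pq pp'; apply: IH qq' _ s.
Qed.

(* Ranks are compared first and ties are broken by codes; both clauses are
   negations of simulations, which keeps the relation Pi^1_1. *)
Definition prec (u v : nat) : Prop :=
  (u < v -> forall c, ch (troot u) c -> ~ sim (troot v) c) /\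
  (~ u < v -> ~ sim (troot v) (troot u)).

(** For [u < v], [prec u v] bounds the rank of [u] by that of [v], while [prec v u] puts the rank of
    [v] strictly below that of [u]. The case [u = v] is excluded by [sim_refl]. *)
Lemma prec_asym u v : acc (troot u) -> acc (troot v) -> prec u v -> ~ prec v u.
Proof.
move=> au av [u1 u2] [v1 v2].
have [uv|vu] := ltnP u v.
  have [s|[c [uc s]]] := sim_total av (troot u); last exact: (u1 uv c uc).
  by apply: v2 s; lia.
have [e|e] := eqVneq u v.
  by subst v; apply: u2 (sim_refl _); lia.
have [s|[c [uc s]]] := sim_total au (troot v).
  by apply: u2 s; lia.
by apply: v1 uc s; lia.
Qed.

Lemma prec_nacc u v : acc (troot u) -> ~ acc (troot v) -> prec u v.
Proof.
move=> au nv; split=> [_ c uc|_] s; case: nv; last exact: (sim_acc s au).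
exact: (sim_acc s (Acc_inv au c uc)).
Qed.

Lemma prec_least (X : nat -> Prop) : (forall u, X u -> acc (troot u)) ->
  (exists u, X u) -> exists u, X u /\ forall v, X v -> v <> u -> prec u v.
Proof.
move=> Xacc [u0 Xu0].
pose minimal u := X u /\ forall v, X v -> ~ exists c, ch (troot u) c /\ sim (troot v) c.
have exmin : exists u, minimal u.
  (* Induction on a node [p] that bounds the rank of some member of [X]; if that member is not
     minimal, a child of [p] bounds another member. *)
  suff h p : acc p -> (exists w, X w /\ sim (troot w) p) -> exists u, minimal u.
    by apply: (h (troot u0) (Xacc _ Xu0)); exists u0; split=> //; exact: sim_refl.
  elim=> {}p _ IH [w [Xw wp]].
  case: (pselect (minimal w)) => [mw|nw]; first by exists w.
  have [v [Xv [c [wc vc]]]] :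
      exists v, X v /\ exists c, ch (troot w) c /\ sim (troot v) c.
    apply: contrapT => h; apply: nw; split=> // v Xv h'; apply: h.
    by exists v.
  have [c' [pc' cc']] := sim_child wp wc.
  by apply: (IH c' pc'); exists v; split=> //; exact: sim_trans vc cc'.
have [u1 mu1] := exmin.
have exb : exists u, `[< minimal u >] by exists u1; apply/asboolP.
case: (ex_minnP exb) => u /asboolP[Xu mu] umin.
exists u; split=> // v Xv vu; split=> [uv c uc s|uv s].
  by apply: (mu v Xv); exists c.
(* Now [v] has the smaller code, so it is not of minimal rank; yet a member of rank below [v] would
   also have rank below [u]. *)
have nv : ~ minimal v.
  by move=> mv; have /umin := introT (asboolP _) mv; lia.
apply: nv; split=> // w Xw [c [vc wc]]; have [c' [uc' cc']] := sim_child s vc.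
by apply: (mu w Xw); exists c'; split=> //; exact: sim_trans wc cc'.
Qed.

End Simulation.

(** * Binary strings and their codes *)

(** [string_code] is the bijective base-2 numeral with digits 1 and 2. *)
Lemma string_code_rcons s (b : bool) :
  string_code (rcons s b) = string_code s + string_code s + b.+1.
Proof. by rewrite /string_code foldl_rcons addnn. Qed.

Lemma string_code_inj : injective string_code.
Proof.
elim/last_ind => [|s b IH] t; case/lastP: t => [|t c] //;
  rewrite ?string_code_rcons => e.
- by move: e; rewrite /string_code /=; lia.
- by move: e; rewrite /string_code /=; lia.
- have [e1 e2] : string_code s = string_code t /\ b = c.
    by case: b c e => [] []; lia.
  by rewrite e2 (IH _ e1).
Qed.

Lemma string_code_surj u : exists s, string_code s = u.
Proof.
elim/ltn_ind: u => -[_|u IH]; first by exists [::].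
have := odd_double_half u; rewrite -addnn => e.
have [s hs] : exists s, string_code s = u./2 by apply: IH; lia.
exists (rcons s (odd u)); rewrite string_code_rcons hs.
by case: odd e => /=; lia.
Qed.

Definition string_of (u : nat) : seq bool := sval (cid (string_code_surj u)).

Lemma string_ofK u : string_code (string_of u) = u.
Proof. by rewrite /string_of; case: cid. Qed.

Lemma string_codeK s : string_of (string_code s) = s.
Proof. by apply: string_code_inj; rewrite string_ofK. Qed.

Definition zero_ext (u : nat) : cantor_space := fun i => nth false (string_of u) i.

Definition pcode (y : cantor_space) (n : nat) : nat := string_code (mkseq y n).

Lemma pcodeS y n : pcode y n.+1 = pcode y n + pcode y n + (y n).+1.
Proof. by rewrite /pcode mkseqS string_code_rcons. Qed.

Lemma pcode_inj y z n : pcode y n = pcode z n -> mkseq y n = mkseq z n.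
Proof. exact: string_code_inj. Qed.

Lemma mkseq_eqP (y z : cantor_space) n :
  mkseq y n = mkseq z n <-> forall i, i < n -> y i = z i.
Proof.
split=> [e i ni|h]; first by rewrite -(nth_mkseq false y ni) e nth_mkseq.
apply: (@eq_from_nth _ false); rewrite !size_mkseq // => i ni.
by rewrite !nth_mkseq // h.
Qed.

Lemma zero_ext_prefix y n i : i < n -> zero_ext (pcode y n) i = y i.
Proof. by move=> ni; rewrite /zero_ext string_codeK nth_mkseq. Qed.

Lemma zero_ext_tail u i : size (string_of u) <= i -> zero_ext u i = false.
Proof. by move=> h; rewrite /zero_ext nth_default. Qed.

Lemma pcode_zero_ext u : pcode (zero_ext u) (size (string_of u)) = u.
Proof. by rewrite /pcode mkseq_nth string_ofK. Qed.

(** An arithmetical description of the functions [pcode y], through which number-valued functions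
    represent reals. *)
Definition walk (h : nat -> nat) : Prop :=
  h 0 = 0 /\ forall n, h n.+1 = (h n + h n).+1 \/ h n.+1 = (h n + h n).+2.

Lemma walk_pcode y : walk (pcode y).
Proof. by split=> // n; rewrite pcodeS; case: (y n); [right|left]; lia. Qed.

Lemma walkP h : walk h -> exists y, h = pcode y.
Proof.
move=> [h0 hS]; exists (fun n => h n.+1 == (h n + h n).+2).
apply/funext; elim=> // n IH; rewrite pcodeS -IH.
by case: (hS n) => ->; rewrite ?eqxx /=; [rewrite (_ : _ == _ = false)|]; lia.
Qed.

(** The number [k] is the length of the string coded by [u]: row [u] passes through [u] there and
    appends only zeros afterwards. *)
Definition zero_ext_spec (v : nat -> nat) : Prop :=
  forall u, v (npair u 0) = 0 /\
    (forall n, v (npair u n.+1) = (v (npair u n) + v (npair u n)).+1 \/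
               v (npair u n.+1) = (v (npair u n) + v (npair u n)).+2) /\
    exists k, v (npair u k) = u /\ forall n, ~ n < k ->
      v (npair u n.+1) = (v (npair u n) + v (npair u n)).+1.

Lemma zero_ext_specP v :
  zero_ext_spec v <-> forall u n, v (npair u n) = pcode (zero_ext u) n.
Proof.
split=> [h u|h u].
  have [h0 [hS [k [hk ht]]]] := h u.
  have [y hy] := walkP (conj h0 hS : walk (fun n => v (npair u n))).
  suff -> : zero_ext u = y by move=> n; rewrite -hy.
  have hy' n : v (npair u n) = pcode y n by rewrite -hy.
  have su : string_of u = mkseq y k.
    by apply: string_code_inj; rewrite string_ofK -hk hy'.
  apply/funext => i; rewrite /zero_ext su.
  have [ik|ki] := ltnP i k; first by rewrite nth_mkseq.
  rewrite nth_default ?size_mkseq //.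
  have := ht i; rewrite !hy' pcodeS => /(_ ltac:(lia)).
  by case: (y i) => //; lia.
have [w0 wS] := walk_pcode (zero_ext u).
split; first by rewrite h.
split=> [n|]; first by rewrite !h; exact: wS.
exists (size (string_of u)); rewrite h pcode_zero_ext; split=> // n nk.
by rewrite !h pcodeS zero_ext_tail; lia.
Qed.

(** On strings of equal length, the order of the codes is the lexicographic one. *)
Lemma lex_ltP y z : lex_lt y z <-> exists n, pcode y n < pcode z n.
Proof.
split=> [[n [h yn zn]]|[n]].
  exists n.+1; rewrite !pcodeS yn zn.
  have -> : pcode y n = pcode z n by congr string_code; apply/mkseq_eqP.
  lia.
elim: n => // n IH; rewrite !pcodeS => lt.
have [lt'|ge] := ltnP (pcode y n) (pcode z n); first exact: IH.
have [e yn zn] : [/\ pcode y n = pcode z n, y n = false & z n = true].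
  by case: (y n) (z n) lt => [] []; split=> //; lia.
by exists n; split=> //; apply/mkseq_eqP; exact: pcode_inj.
Qed.

Lemma lex_lt_irr y : ~ lex_lt y y.
Proof. by move=> [n [_ ->]]. Qed.

Lemma lex_lt_trans y x z : lex_lt x y -> lex_lt y z -> lex_lt x z.
Proof.
move=> [n [hn xn yn]] [m [hm ym zm]]; have [nm|mn|e] := ltngtP n m.
- exists n; split=> // [i ni|]; last by rewrite -hm.
  by rewrite hn // hm //; lia.
- exists m; split=> // [i im|]; last by rewrite hn.
  by rewrite hn ?hm //; lia.
- by move: ym; rewrite -e yn.
Qed.

Lemma lex_lt_total y z : y <> z -> lex_lt y z \/ lex_lt z y.
Proof.
move=> ne.
have ex : exists n, y n != z n.
  apply: contrapT => h; apply: ne; apply/funext => i; apply/eqP.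
  by apply: contrapT => /negP hi; apply: h; exists i.
case: (ex_minnP ex) => n yz nmin.
have eq i : i < n -> y i = z i.
  by move=> ni; apply/eqP; apply: contraLR ni => /nmin; rewrite -leqNgt.
by move: yz; case yn: (y n); case zn: (z n) => // _; [right|left];
  exists n; split=> // i /eq.
Qed.

(** The zero extension of a string is the least point of its cylinder. *)
Lemma lex_le_zero_ext y n : ~ lex_lt y (zero_ext (pcode y n)).
Proof.
move=> [m [h ym zm]]; have [mn|nm] := ltnP m n.
  by move: zm; rewrite zero_ext_prefix // ym.
by move: zm; rewrite zero_ext_tail // string_codeK size_mkseq.
Qed.

(** * Topology and measure on Cantor space *)

Lemma open_prefix (m : nat) (P : seq bool -> Prop) :
  open [set y : cantor_space | P (mkseq y m)].
Proof.
rewrite openE => y Py; rewrite /interior.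
suff : \forall z \near nbhs y, forall i, (i < m)%N -> z i = y i.
  apply: filterS => z zy /=.
  by rewrite (_ : mkseq z m = mkseq y m) //; apply/mkseq_eqP.
elim: m {Py} => [|m IH]; first exact: nearW.
have near1 : \forall z \near nbhs y, z m = y m.
  have := @proj_continuous nat (fun=> bool) m y [set b | b = y m].
  by apply; rewrite /= nbhs_principalE.
apply: filterS2 IH near1 => z h e i; rewrite ltnS leq_eqVlt => /orP[/eqP -> //|].
exact: h.
Qed.

Lemma cylinderP (s : seq bool) (y : cantor_space) :
  cylinder s y <-> forall i, (i < size s)%N -> y i = nth false s i.
Proof.
rewrite /cylinder /=; split=> [e i si|h]; first by rewrite -[in RHS]e nth_mkseq.
apply: (@eq_from_nth _ false); rewrite size_mkseq // => i si.
by rewrite nth_mkseq // h.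
Qed.

(* A lexicographic maximum of [C] in a cylinder is determined by the cylinder,
   so such maxima form a countable set. *)
Lemma null_maxima (R : realType) (C : set cantor_space) :
  (forall y, C y -> exists s, cylinder s y /\
     forall z, C z -> cylinder s z -> ~ lex_lt y z) ->
  null R C.
Proof.
move=> Cmax; rewrite /null /coin_outer; apply/eqP; rewrite eq_le; apply/andP; split.
  apply/lee_addgt0Pr => e e0; rewrite add0e.
  have [j je] : exists j, (2^-1 ^+ j <= e :> R)%R.
    have : (2^-1 ^+ n : R)%R @[n --> \oo] --> (0 : R)%R.
      by apply: cvg_expr; rewrite ger0_norm; lra.
    move/cvgrPdist_le => /(_ e e0)[j _ /(_ j (leqnn j))]; rewrite sub0r normrN.
    by exists j; apply: le_trans _; first exact: ler_norm.
  pose maxin k y := [/\ C y, cylinder (string_of k) y &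
    forall z, C z -> cylinder (string_of k) z -> ~ lex_lt y z].
  pose pt k := get (maxin k).
  (* The [k]-th cylinder has measure 2^-(j+k+1), so the total is 2^-j, at most [e]. Where no maximum
     exists, [get] returns a default point and the cover only grows. *)
  pose s k := mkseq (pt k) (j + k.+1).
  apply: ge_ereal_inf; exists (\sum_(k <oo) (2^-1 ^+ size (s k))%:E)%E.
    exists s => // y Cy; have [t [ty tmax]] := Cmax y Cy.
    exists (string_code t) => //.
    have my : maxin (string_code t) y by rewrite /maxin string_codeK.
    have /getPex[Cz cz zmax] : exists z, maxin (string_code t) z by exists y.
    rewrite /s /cylinder /= size_mkseq; congr mkseq.
    apply: contrapT => /lex_lt_total; case: my => _ cy ymax [].
      exact: ymax.
    exact: zmax.
  have sE k : (2^-1 ^+ size (s k) = 2^-1 ^+ j / (2 ^ k.+1)%:R :> R)%R.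
    by rewrite size_mkseq exprD natrX exprVn [(2^-1 ^+ k.+1)%R]exprVn.
  apply: le_trans (_ : ((2^-1 ^+ j)%:E <= e%:E)%E); last by rewrite lee_fin.
  under eq_eseriesr do rewrite sE.
  exact: epsilon_trick0.
apply: le_ereal_inf_tmp => _ [s _ <-]; apply: nneseries_ge0 => k _ _.
by rewrite lee_fin exprn_ge0.
Qed.

(** * The test *)

Lemma arithdef_entry_spec S (fn : S -> nat -> nat -> nat) (en : S -> seq nat) :
  arithdef fn en (fun s => entry_spec (fn s 0)).
Proof. by rewrite /entry_spec; ad. Qed.

Lemma arithdef_zero_ext_spec j S (fn : S -> nat -> nat -> nat) (en : S -> seq nat) :
  arithdef fn en (fun s => zero_ext_spec (fn s j)).
Proof. by rewrite /zero_ext_spec; ad. Qed.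

(** Slot 0 holds the table of zero extensions, slot 1 the path as a walk, and the later slots pack,
    in row [n], the witnesses that its prefix of length [n] is in [T]. *)
Lemma Sigma11_path_below T : Sigma11 T -> exists b, forall u,
  (exists F, holds F [:: u] b) <->
  (exists y, paths T y /\ lex_lt y (zero_ext u)).
Proof.
move=> [a Ta].
have [b hb] : arithdef (fun s : (nat -> nat -> nat) * nat => s.1) (fun s => [:: s.2])
    (fun s => zero_ext_spec (s.1 0) /\ walk (s.1 1) /\
      (forall n, holds (fun j x => s.1 j.+2 (npair n x)) [:: s.1 1 n] a) /\
      exists n, s.1 1 n < s.1 0 (npair s.2 n)).
  apply: arithdef_and; first exact: arithdef_zero_ext_spec.
  rewrite /walk; ad.
  apply: arithdef_holds => [j|[|i]] /=.
  - by apply: (@termdef_app _ (xfn _) _ j.+2); tm.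
  - by tm.
  - by rewrite nth_nil; exact: termdef0.
exists b => u; split=> [[F /(hb (F, u))/= [/zero_ext_specP hv [/walkP[y hy] [hF [n hn]]]]]|].
  exists y; split=> [k|]; last by apply/lex_ltP; exists n; rewrite -hv -hy.
  by apply/Ta; eexists; rewrite -/(pcode y k) -hy; exact: hF.
move=> [y [py /lex_ltP[n hn]]].
have [v hv] := npair_join (fun u => pcode (zero_ext u)).
have /choice[K hK] : forall n, exists F, holds F [:: pcode y n] a.
  by move=> k; apply/Ta; exact: py.
have /choice[J hJ] : forall j, exists h : nat -> nat,
    forall k x, h (npair k x) = K k j x by move=> j; exact: npair_join.
exists (fun j => match j with 0 => v | 1 => pcode y | j'.+2 => J j' end).
apply/(hb (_, u)) => /=; split; first by apply/zero_ext_specP.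
split; first exact: walk_pcode.
split=> [k|]; last by exists n; rewrite hv.
rewrite (_ : (fun j x => J j (npair k x)) = K k) //.
by apply/funext => j; apply/funext => x; rewrite hJ.
Qed.

Section Test.
Variable ch : nat -> nat -> Prop.

Definition record (u : nat) : Prop := Acc (fun y x => ch x y) (troot u) /\
  forall v, lex_lt (zero_ext u) (zero_ext v) -> prec ch u v.

Definition record_test (m : nat) : set cantor_space :=
  [set y | exists u, record u /\ mkseq (zero_ext u) m = mkseq y m].

Lemma record_test_open m : open (record_test m).
Proof.
exact: (open_prefix m (fun s => exists u, record u /\ mkseq (zero_ext u) m = s)).
Qed.

Lemma record_test_null (R : realType) : null R (\bigcap_m record_test m).
Proof.
apply: null_maxima => y _; set C := bigcap _ _.
pose X u := record u /\ lex_lt y (zero_ext u).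
have above z n : C z -> lex_lt y z -> (forall i, i < n -> z i = y i) ->
    exists u, X u /\ forall i, i < n -> zero_ext u i = y i.
  move=> Cz [k [hk yk zk]] zy.
  have [u [ru /mkseq_eqP hu]] := Cz (maxn n k.+1) I.
  exists u; split=> [|i ni]; last by rewrite hu ?zy //; lia.
  split=> //; exists k; split=> // [i ik|]; last by rewrite hu //; lia.
  by rewrite hk // hu //; lia.
(* If no record has its zero extension above [y], then [y] is the largest point of [C] and the empty
   string serves. *)
case: (pselect (exists u, X u)) => [exX|noX]; last first.
  exists [::]; split=> // z Cz _ yz; apply: noX.
  by have [//|u [Xu _]] := above z 0 Cz yz; exists u.
have Xacc u : X u -> Acc (fun y x => ch x y) (troot u) by move=> [[]].
(* Take the earliest record [u] above [y], first differing from [y] at [n]. A point of [C] above [y]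
   with the same first [n.+1] bits would give a record [v] lying between [y] and [zero_ext u]: then
   [v] precedes [u] as a record, and [u] precedes [v] by choice. *)
have [u [[[au ru] [n [hn yn un]]] umin]] := prec_least Xacc exX.
exists (mkseq y n.+1); split=> [|z Cz /cylinderP].
  by apply/cylinderP => i; rewrite size_mkseq => ni; rewrite nth_mkseq.
rewrite size_mkseq => zy yz.
have [|v [[[av rv] yv] hv]] := above z n.+1 Cz yz.
  by move=> i ni; rewrite zy // nth_mkseq.
have vu : lex_lt (zero_ext v) (zero_ext u).
  exists n; split=> // [i ni|]; last by rewrite hv.
  by rewrite hv ?hn // ltnW.
have pvu := rv u vu.
have [e|ne] := eqVneq v u; first by move: vu; rewrite e => /lex_lt_irr.
have puv : prec ch u v by apply: umin; [|exact/eqP].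
exact: (prec_asym au av puv pvu).
Qed.

(** Membership in [record_test m] depends on [m] bits only, so zero extensions suffice as test
    points and the quantifier over reals becomes a number quantifier. *)
Lemma cylinder_record_test m s :
  cylinder s `<=` record_test m <->
  forall w, (exists n, pcode (zero_ext w) n = string_code s) ->
    exists u, record u /\ pcode (zero_ext u) m = pcode (zero_ext w) m.
Proof.
split=> [h w [n /string_code_inj e]|h y /cylinderP sy].
  have sw : cylinder s (zero_ext w) by rewrite /cylinder /= -e size_mkseq.
  by have [u [ru e']] := h _ sw; exists u; split=> //; rewrite /pcode e'.
pose w := pcode y (maxn m (size s)).
have wy i : i < maxn m (size s) -> zero_ext w i = y i by exact: zero_ext_prefix.
have [|u [ru /pcode_inj e]] := h w.
  exists (size s); congr string_code; apply/cylinderP => i si.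
  by rewrite wy ?sy //; lia.
exists u; split=> //; rewrite e; apply/mkseq_eqP => i im.
by rewrite wy //; lia.
Qed.

Hypothesis ch_def : exists a, forall F p q,
  (forall c i, F 0 (npair c i) = entry c i) -> (holds F [:: p; q] a <-> ch p q).
Variable b : arith.
Hypothesis b_acc : forall u,
  (exists F, holds F [:: u] b) <-> ~ Acc (fun y x => ch x y) (troot u).

(* [r] and [K] are attempts to refute that [u] is a record. *)
Let unrefuted (c : nat -> nat -> Prop) (lt : nat -> nat -> Prop)
    (r : nat -> nat -> nat) (K : nat -> nat -> nat) (u : nat) : Prop :=
  let refutes p q := (forall p q, r p q = 0 -> forall p', c p p' ->
                        exists q', c q q' /\ r p' q' = 0) /\ r p q = 0 in
  ~ holds K [:: u] b /\ forall v, lt u v ->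
    (u < v -> forall q, c (troot u) q -> ~ refutes (troot v) q) /\
    (~ u < v -> ~ refutes (troot v) (troot u)).

Let lex u v := lex_lt (zero_ext u) (zero_ext v).

(** Relations are represented by zero sets of functions, so being a record becomes universal in the
    functions [r] and [K]. *)
Lemma recordP u : record u <-> forall r K, unrefuted ch lex r K u.
Proof.
split=> [[au ru] r K|h].
  split=> [hK|v uv]; first by case: (b_acc u) => /(_ (ex_intro _ K hK)).
  have [p1 p2] := ru v uv; split=> [lt q uq [rs rq]|lt [rs rq]].
    by apply: (p1 lt q uq); exists (fun p q => r p q = 0).
  by apply: (p2 lt); exists (fun p q => r p q = 0).
split.
  apply: contrapT => /b_acc[K hK]; by have [] := h (fun _ _ => 0) K.
have mk (r : nat -> nat -> Prop) :
    exists r' : nat -> nat -> nat, forall p q, r' p q = 0 <-> r p q.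
  exists (fun p q => if `[< r p q >] then 0 else 1) => p q.
  by case: asboolP.
move=> v uv; split=> [lt q uq|lt] [r [rs rq]]; have [r' rr] := mk r;
  have [_ /(_ v uv)[h1 h2]] := h r' (fun _ _ => 0).
  apply: (h1 lt q uq); split; last exact/rr.
  move=> x y /rr xy x' xx'; have [y' [? ?]] := rs _ _ xy _ xx'.
  by exists y'; split=> //; apply/rr.
apply: (h2 lt); split; last exact/rr.
move=> x y /rr xy x' xx'; have [y' [? ?]] := rs _ _ xy _ xx'.
by exists y'; split=> //; apply/rr.
Qed.

(** The function quantifiers behind the number quantifier over [u] move to the front by choice: one
    attempted refutation for every [u] at once, stored in row [u]. *)
Lemma record_test_Pi11 : Pi11 (fun m s => cylinder s `<=` record_test m).
Proof.
have [a ha] := ch_def.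
pose c (F : nat -> nat -> nat) p q := holds F [:: p; q] a.
pose lt (F : nat -> nat -> nat) u v := exists n, F 1 (npair u n) < F 1 (npair v n).
(* Slot 0 computes [entry], slot 1 the zero extensions, slot 2 the simulations and the slots from 3
   on the witnesses for [b]; the specifications guard the first two. *)
have [f hf] : arithdef (fun s : (nat -> nat -> nat) * nat * nat => s.1.1)
    (fun s => [:: s.1.2; s.2])
    (fun s => entry_spec (s.1.1 0) -> zero_ext_spec (s.1.1 1) ->
      forall w, (exists n, s.1.1 1 (npair w n) = s.2) -> exists u,
        unrefuted (c s.1.1) (lt s.1.1)
          (fun p q => s.1.1 2 (npair u (npair p q)))
          (fun j x => s.1.1 j.+3 (npair u x)) u /\
        s.1.1 1 (npair u s.1.2) = s.1.1 1 (npair w s.1.2)).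
  apply: arithdef_imp; first exact: arithdef_entry_spec.
  apply: arithdef_imp; first exact: arithdef_zero_ext_spec.
  rewrite /unrefuted /c /lt /troot; ad; try by apply: arithdef_holds2; tm.
  apply: arithdef_holds => [j|[|i]] /=.
  - by apply: (@termdef_app _ (xfn _) _ j.+3); tm.
  - by tm.
  - by rewrite nth_nil; exact: termdef0.
exists f => m s; rewrite cylinder_record_test.
have cE F : entry_spec (F 0) -> c F = ch.
  move=> /entry_specP hF; apply/funext => p; apply/funext => q.
  by apply/propext; exact: ha.
have ltE F : zero_ext_spec (F 1) -> lt F = lex.
  move=> /zero_ext_specP hF; apply/funext => u; apply/funext => v.
  apply/propext; rewrite /lex lex_ltP.
  by split=> -[n hn]; exists n; move: hn; rewrite !hF.
split=> [h F|h w hw].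
  apply/(hf (F, m, string_code s)) => /= hE hZ w [n hn].
  rewrite cE // ltE //; move/zero_ext_specP: hZ => hZ.
  have [|u [/recordP ru e]] := h w; first by exists n; rewrite -hZ.
  by exists u; split=> //; rewrite !hZ.
(* If no [u] worked for [w], choosing a refutation for each candidate and packing them all into one
   [F] would falsify the formula. *)
apply: contrapT => hno.
have /choice[r hr] : forall u, exists r,
    pcode (zero_ext u) m = pcode (zero_ext w) m ->
    exists K, ~ unrefuted ch lex r K u.
  move=> u; case: (pselect (exists r K, ~ unrefuted ch lex r K u)) => [[r [K hK]]|hu].
    by exists r => _; exists K.
  exists (fun _ _ => 0) => e; case: hno; exists u; split; last exact: e.
  apply/recordP => r K.
  by apply: contrapT => hK; apply: hu; exists r, K.
have /choice[K hK] : forall u, exists K,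
    pcode (zero_ext u) m = pcode (zero_ext w) m -> ~ unrefuted ch lex (r u) K u.
  move=> u; case: (pselect (pcode (zero_ext u) m = pcode (zero_ext w) m)) => [/hr[K hK]|hu].
    by exists K.
  by exists (fun _ _ => 0).
have [d hd] := npair_join entry.
have [v hv] := npair_join (fun u => pcode (zero_ext u)).
have /choice[r' hr'] : forall u, exists h, forall p q, h (npair p q) = r u p q.
  by move=> u; exact: npair_join.
have [r2 hr2] := npair_join r'.
have /choice[J hJ] : forall j, exists h : nat -> nat,
    forall u x, h (npair u x) = K u j x by move=> j; exact: npair_join.
pose F j := match j with 0 => d | 1 => v | 2 => r2 | j'.+3 => J j' end.
have hE : entry_spec (F 0) by apply/entry_specP.
have hZ : zero_ext_spec (F 1) by apply/zero_ext_specP.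
have /(hf (F, m, string_code s))/(_ hE hZ w) := h F.
case=> [|u /=]; first by have [n hn] := hw; exists n; rewrite /= hv.
rewrite cE // ltE // !hv => -[hu e]; apply: (hK u e).
have e2 : (fun p q => r2 (npair u (npair p q))) = r u.
  by apply/funext => p; apply/funext => q; rewrite hr2 hr'.
have e3 : (fun j x => J j (npair u x)) = K u.
  by apply/funext => j; apply/funext => x; rewrite hJ.
by move: hu; rewrite e2 e3.
Qed.

End Test.

(** * The leftmost path lies in every set of the test *)

Theorem mainTheorem14 (R : realType) (T : set (seq bool)) (x : cantor_space)
    (treeT : is_tree T) (SigmaT : Sigma11 T) (xT : leftmost (paths T) x) :
  ~ Pi11_weakly_2_random R x.
Proof.
have [b hb] := Sigma11_path_below SigmaT.
have [ch [ch_def b_acc]] := tree_normal_form b.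
have [px xmin] := xT.
(* Some path lies below [zero_ext u] exactly when the leftmost one does. *)
have accE u : Acc (fun y x => ch x y) (troot u) <-> ~ lex_lt x (zero_ext u).
  rewrite -[Acc _ _]notK -b_acc hb; split=> h.
    by move=> xu; apply: h; exists x.
  move=> [y [py yu]]; apply: h; have [-> //|xy] := xmin y py.
  exact: lex_lt_trans xy yu.
move=> /(_ (record_test ch)); apply.
  split; [exact: record_test_open|exact: record_test_Pi11|].
  exact: record_test_null.
move=> m _.
pose X u := Acc (fun y x => ch x y) (troot u) /\ mkseq (zero_ext u) m = mkseq x m.
have Xacc u : X u -> Acc (fun y x => ch x y) (troot u) by move=> [].
have exX : exists u, X u.
  exists (pcode x m); split; first by apply/accE; exact: lex_le_zero_ext.
  by apply/mkseq_eqP => i im; rewrite zero_ext_prefix.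
have [u [[au ux] umin]] := prec_least Xacc exX.
exists u; split=> //; split=> // v uv.
case: (pselect (Acc (fun y x => ch x y) (troot v))) => [av|]; last exact: prec_nacc.
apply: umin; last by move=> e; move: uv; rewrite e; exact: lex_lt_irr.
split=> //; apply/mkseq_eqP.
have /mkseq_eqP uxE := ux.
(* If [zero_ext v] left [zero_ext u] upwards before [m], it would exceed [x], contradicting the rank
   of [v]. Hence [v] agrees with [x] on [m] bits, and the choice of [u] applies to it. *)
have [n [hn un vn]] := uv; have [nm|mn] := ltnP n m; last first.
  by move=> i im; rewrite -hn ?uxE //; exact: leq_trans im mn.
case/accE: av; exists n; split=> [i ni||//]; last by rewrite -uxE.
by rewrite -hn // uxE //; exact: ltn_trans ni nm.
Qed.
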